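(* Let $q=mf+1$ be a power of a prime, with $m,f$ positive integers. Suppose $f+1=\lambda m$ with $\lambda$ an integer, and let $\chi$ be a multiplicative character of order $m$ on $\mathbb{F}_q$. Then $M_{q,m}$ is a $(q,f+1,\lambda)$-difference set in $\mathbb{F}_q$ if and only if $$\sum_{\alpha\in H_{q,m}}\chi^s(1-\alpha)=-1-\chi^s(-1),\quad s=1,\ldots,m-1.$$
   Context: $H_{q,m}$ denotes the set of nonzero $m$th powers in $\mathbb{F}_q$ and $M_{q,m}=H_{q,m}\cup\{0\}$. A subset $D\subseteq\mathbb{F}_q$ of size $k$ is a $(q,k,\lambda)$-difference set in $\mathbb{F}_q$ if for each nonzero $a\in\mathbb{F}_q$ there are exactly $\lambda$ ordered pairs $(x,y)\in D\times D$ with $x-y=a$. A multiplicative character on $\mathbb{F}_q$ is a homomorphism $\mathbb{F}_q^*\to\mathbb{C}^*$ extended to $0$ by the value $1$ if the character is trivial and $0$ if it is nontrivial. For $s\in\mathbb{Z}$, $\chi^s$ is the $s$th power of $\chi$ as a character of $\mathbb{F}_q^*$, extended to $0$ by this same rule. *)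

(* Defs.v *)
From mathcomp Require Import all_boot all_order all_algebra complex reals.

Set Implicit Arguments.
Unset Strict Implicit.
Unset Printing Implicit Defensive.

Import GRing.Theory.
Local Open Scope ring_scope.

Section PowerResidues.
Variables (F : finFieldType) (m : nat).

Definition Hset : {set F} := [set x : F | (x != 0) && [exists y : F, x == y ^+ m]].

Definition Mset : {set F} := Hset :|: [set 0].

End PowerResidues.

Definition is_difference_set (F : finFieldType) (q k lambda : nat) (D : {set F}) : Prop :=
  [/\ #|F| = q, #|D| = k &
      forall a : F, a != 0 ->
        #|[set p in setX D D | p.1 - p.2 == a]| = lambda].

(* A homomorphism from F^* to C^*; that it maps 1 to 1 follows from the two
   axioms. Evaluation at elements of F, including 0, is [mchar_eval]. *)
Record mchar (F : finFieldType) (C : fieldType) := MChar {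
  mchar_fun :> {unit F} -> C;
  mchar_neq0 : forall u, mchar_fun u != 0;
  mcharM : forall u v, mchar_fun (u * v)%g = mchar_fun u * mchar_fun v
}.

Section MultiplicativeCharacters.
Variables (F : finFieldType) (C : fieldType).
Implicit Type chi : mchar F C.

Definition mchar_trivial chi : bool := [forall u, chi u == 1].

Fact mchar_exp_neq0 chi (s : int) u : chi u ^ s != 0.
Proof. by rewrite expfz_neq0 // mchar_neq0. Qed.

Fact mchar_expM chi (s : int) u v : chi (u * v)%g ^ s = chi u ^ s * chi v ^ s.
Proof. by rewrite mcharM expfzMl. Qed.

Definition mchar_exp chi (s : int) : mchar F C :=
  MChar (mchar_exp_neq0 chi s) (mchar_expM chi s).

(* [insub x] is [None] exactly when x = 0, since F is a field. *)
Definition mchar_eval chi (x : F) : C :=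
  if insub x is Some u then chi u else (mchar_trivial chi)%:R.

Definition mchar_has_order chi (m : nat) : Prop :=
  [/\ (0 < m)%N, mchar_trivial (mchar_exp chi m%:Z) &
      forall k : nat, (0 < k < m)%N -> ~~ mchar_trivial (mchar_exp chi k%:Z)].

End MultiplicativeCharacters.

(* Main.v *)
Require Import Defs.
From mathcomp Require Import all_boot all_order all_algebra complex reals.
From mathcomp Require Import fingroup cyclic.

(** Let [N a] be the number of ways to write a unit [a] as a difference of two
    elements of [M = Mset F m].  As [M] is stable under multiplication by the
    nonzero [m]th powers, [N] is constant on their cosets.  These cosets are
    those of the kernel of [chi] ([Hset_mchar_ker], because the group of units
    is cyclic), so [N] is a function on a group of order [m] whose characters
    are the powers of [chi].  By Fourier inversion, [N] is constant if and only
    if the sum of [N a * chi a ^ s] over the units vanishes for [0 < s < m]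
    ([coset_invariant_const]).  The constant is then the mean of [N], which is
    [(f + 1) f / (m f) = lambda] ([sum_diff_count_units]).

    It remains to evaluate these sums as character sums over pairs in [M].
    Factoring [x - y] as [x (1 - y / x)] gives
    [f (1 + chi ^ s (-1) + S)], where [S] is the sum of
    [chi ^ s (1 - alpha)] over the nonzero [m]th powers [alpha]
    ([sum_diff_count_mchar]).  Since [f] is invertible in a field of
    characteristic zero, this vanishes exactly when [S = -1 - chi ^ s (-1)]. *)

Set Implicit Arguments.
Unset Strict Implicit.
Unset Printing Implicit Defensive.

Import GRing.Theory Num.Theory.
Local Open Scope ring_scope.

(** * Characters of the group of units *)

Lemma mchar1 (F : finFieldType) (C : fieldType) (chi : mchar F C) :
  chi 1%g = 1.
Proof.
by apply: (mulfI (mchar_neq0 chi 1%g)); rewrite -mcharM mulg1 mulr1.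
Qed.

Lemma mcharX (F : finFieldType) (C : fieldType) (chi : mchar F C)
    (u : {unit F}) (n : nat) :
  chi (u ^+ n)%g = chi u ^+ n.
Proof.
by elim: n => [|n IHn]; rewrite ?expg0 ?expr0 ?mchar1 // expgS mcharM IHn exprS.
Qed.

Lemma mchar_expE (F : finFieldType) (C : fieldType) (chi : mchar F C)
    (s : nat) (u : {unit F}) :
  mchar_exp chi s%:Z u = chi u ^+ s.
Proof. by []. Qed.

(** Translating the summation variable by a unit [v] multiplies the sum by
    [chi v], which can be chosen different from [1]. *)
Lemma mchar_sum_eq0 (F : finFieldType) (C : fieldType) (chi : mchar F C) :
  ~~ mchar_trivial chi -> \sum_u chi u = 0.
Proof.
case/forallPn => v chi_v.
have /eqP : (1 - chi v) * (\sum_u chi u) = 0.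
  apply/eqP; rewrite mulrBl mul1r subr_eq0; apply/eqP.
  rewrite mulr_sumr (reindex_inj (mulgI v)) /=.
  by apply: eq_bigr => u _; rewrite mcharM.
by rewrite mulf_eq0 subr_eq0 eq_sym (negPf chi_v) => /eqP.
Qed.

Lemma mchar_orderX (F : finFieldType) (C : fieldType) (chi : mchar F C)
    (m : nat) (u : {unit F}) :
  mchar_has_order chi m -> chi u ^+ m = 1.
Proof. by case=> _ /forallP/(_ u)/eqP. Qed.

Lemma mchar_powers_sum (F : finFieldType) (C : fieldType) (chi : mchar F C)
    (m : nat) (u : {unit F}) :
  mchar_has_order chi m ->
  \sum_(s < m) chi u ^+ s = if chi u == 1 then m%:R else 0.
Proof.
move=> chi_m; case: eqP => [->|/eqP chi_u].
  under eq_bigr => s _ do rewrite expr1n.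
  by rewrite sumr_const card_ord.
have /eqP : (chi u - 1) * (\sum_(s < m) chi u ^+ s) = 0.
  by rewrite -subrX1 (mchar_orderX u chi_m) subrr.
by rewrite mulf_eq0 subr_eq0 (negPf chi_u) => /eqP.
Qed.

(** Fourier inversion using only the powers of [chi].  Averaging over the
    characters [chi ^ s], [s < m], detects the kernel of [chi] instead of the
    identity, so what is recovered is the average of [g] over the coset of [b]
    modulo the kernel; the hypothesis makes that average equal to [g b]. *)
Lemma mchar_inversion (F : finFieldType) (C : fieldType) (chi : mchar F C)
    (m : nat) (g : {unit F} -> C) (b : {unit F}) :
  mchar_has_order chi m ->
  (forall u v, chi v = 1 -> g (u * v)%g = g u) ->
  m%:R * #|[set u | chi u == 1]|%:R * g b
    = \sum_(s < m) (chi b ^+ s)^-1 * \sum_u g u * chi u ^+ s.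
Proof.
move=> chi_m g_ker.
(* After u = b * v the factor chi b ^ s cancels, leaving powers of chi v. *)
under eq_bigr => s _.
  rewrite mulr_sumr (reindex_inj (mulgI b)) /=.
  under eq_bigr => v _ do
    rewrite mcharM exprMn [_ * (_ * _)]mulrCA mulKf ?expf_neq0 ?mchar_neq0 //.
  over.
rewrite exchange_big /=.
under eq_bigr => v _ do
  rewrite -mulr_sumr (mchar_powers_sum v chi_m) (fun_if ( *%R _)) mulr0.
rewrite -big_mkcond /= (eq_bigr (fun=> m%:R * g b)) => [|v /eqP/g_ker ->].
  rewrite sumr_const -[RHS]mulr_natr mulrAC; congr (_ * _%:R).
  by apply: eq_card => v; rewrite !inE.
by rewrite mulrC.
Qed.

(** This is the inversion formula for the constant function [1]: only the term
    [s = 0] survives by orthogonality, and it counts all units. *)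
Lemma mchar_ker_card (F : finFieldType) (C : numFieldType) (chi : mchar F C)
    (m : nat) :
  mchar_has_order chi m -> (m * #|[set u | chi u == 1%R]| = #|{: {unit F}}|)%N.
Proof.
move=> chi_m; have [m_gt0 _ chi_nt] := chi_m.
apply/eqP; rewrite -(eqr_nat C) natrM; apply/eqP.
rewrite -[LHS]mulr1 (mchar_inversion (g := fun=> 1) 1%g chi_m) //.
case: m m_gt0 chi_nt {chi_m} => // m _ chi_nt.
rewrite big_ord_recl [X in _ + X]big1 ?addr0 => [|s _].
  under eq_bigr do rewrite expr0 mul1r.
  by rewrite expr0 invr1 mul1r sumr_const.
under eq_bigr do rewrite mul1r -mchar_expE.
by rewrite mchar_sum_eq0 ?mulr0 // chi_nt //= ltnS.
Qed.

(** A function on the quotient by the kernel of [chi] has the sums against the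
    powers of [chi] as its Fourier coefficients.  It is constant exactly when
    the coefficients with [s != 0] vanish; the one with [s = 0] fixes the
    constant. *)
Lemma coset_invariant_const (F : finFieldType) (C : numFieldType)
    (chi : mchar F C) (m : nat) (g : {unit F} -> C) (c : C) :
  mchar_has_order chi m ->
  (forall u v, chi v = 1 -> g (u * v)%g = g u) ->
  \sum_u g u = #|{: {unit F}}|%:R * c ->
  (forall u, g u = c) <->
  (forall s : nat, (0 < s < m)%N -> \sum_u g u * chi u ^+ s = 0).
Proof.
move=> chi_m g_ker sum_g; have [m_gt0 _ chi_nt] := chi_m.
split=> [gc s s_m|vanish b].
  under eq_bigr do rewrite gc -mchar_expE.
  by rewrite -mulr_sumr mchar_sum_eq0 ?mulr0 ?chi_nt.
have U_neq0 : #|{: {unit F}}|%:R != 0 :> C.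
  by rewrite pnatr_eq0 -lt0n; apply/card_gt0P; exists 1%g.
apply: (mulfI U_neq0); rewrite -sum_g -(mchar_ker_card chi_m) natrM.
rewrite (mchar_inversion _ chi_m) //.
case: m m_gt0 {chi_m chi_nt} vanish => // m _ vanish.
rewrite big_ord_recl [X in _ + X]big1 ?addr0 => [|s _].
  by under eq_bigr do rewrite expr0 mulr1; rewrite expr0 invr1 mul1r.
by rewrite vanish ?mulr0 //= ltnS.
Qed.

(** * The nonzero mth powers as the kernel of a character of order m *)

Lemma Hset_neq0 (F : finFieldType) (m : nat) (x : F) : x \in Hset F m -> x != 0.
Proof. by rewrite inE => /andP[]. Qed.

Lemma Hset0 (F : finFieldType) (m : nat) : 0 \notin Hset F m.
Proof. by rewrite inE eqxx. Qed.

Lemma Hset_mulM (F : finFieldType) (m : nat) (x y : F) :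
  x \in Hset F m -> y \in Hset F m -> x * y \in Hset F m.
Proof.
rewrite !inE => /andP[x0 /existsP[a /eqP ax]] /andP[y0 /existsP[b /eqP yb]].
by rewrite mulf_neq0 //=; apply/existsP; exists (a * b); rewrite exprMn -ax -yb.
Qed.

Lemma HsetV (F : finFieldType) (m : nat) (x : F) :
  x \in Hset F m -> x^-1 \in Hset F m.
Proof.
rewrite !inE => /andP[x0 /existsP[a /eqP ax]].
by rewrite invr_neq0 //=; apply/existsP; exists a^-1; rewrite exprVn -ax.
Qed.

Lemma Hset_mull (F : finFieldType) (m : nat) (x y : F) :
  x \in Hset F m -> (x * y \in Hset F m) = (y \in Hset F m).
Proof.
move=> Hx; apply/idP/idP => [Hxy|]; last exact: Hset_mulM.
by rewrite -(mulKf (Hset_neq0 Hx) y); apply: Hset_mulM => //; apply: HsetV.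
Qed.

Lemma Mset_mull (F : finFieldType) (m : nat) (x y : F) :
  x \in Hset F m -> (x * y \in Mset F m) = (y \in Mset F m).
Proof.
move=> Hx; rewrite !in_setU !in_set1 Hset_mull // mulf_eq0.
by rewrite (negPf (Hset_neq0 Hx)).
Qed.

Lemma card_Mset (F : finFieldType) (m : nat) :
  #|Mset F m| = (#|Hset F m| + 1)%N.
Proof. by rewrite /Mset setUC cardsU1 Hset0 addnC. Qed.

Lemma big_Mset (F : finFieldType) (m : nat) (V : zmodType) (g : F -> V) :
  \sum_(x in Mset F m) g x = g 0 + \sum_(x in Hset F m) g x.
Proof. by rewrite /Mset setUC big_setU1 ?Hset0. Qed.

(** An [m]th power is killed since [chi ^ m = 1].  Conversely, let [g] generate
    the cyclic group of units.  As [chi] is determined by [chi g], the latter is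
    a primitive [m]th root of unity, so [chi (g ^ i) = 1] forces [m] to divide
    [i]. *)
Lemma Hset_mchar_ker (F : finFieldType) (C : fieldType) (chi : mchar F C)
    (m : nat) (u : {unit F}) :
  mchar_has_order chi m -> (val u \in Hset F m) = (chi u == 1).
Proof.
move=> chi_m; have [m_gt0 _ chi_nt] := chi_m.
have uval_neq0 v : val (v : {unit F}) != 0 by rewrite -unitfE (valP v).
apply/idP/eqP => [|chi_u].
  rewrite inE => /andP[_ /existsP[y /eqP uy]].
  have y_unit : y \is a GRing.unit.
    rewrite unitfE; apply: contraNneq (uval_neq0 u) => y0.
    by rewrite uy y0 expr0n gtn_eqF.
  have -> : u = (FinRing.unit F y_unit ^+ m)%g.
    by apply: val_inj; rewrite FinRing.val_unitX.
  by rewrite mcharX (mchar_orderX _ chi_m).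
have /cyclicP[g Ug] := field_unit_group_cyclic [set: {unit F}]%G.
have powg v : exists i, v = (g ^+ i)%g by apply/cycleP; rewrite -Ug inE.
have [i u_gi] := powg u.
have gi_modm : chi g ^+ (i %% m) = 1.
  move: chi_u; rewrite u_gi mcharX {1}(divn_eq i m) exprD mulnC exprM.
  by rewrite (mchar_orderX g chi_m) expr1n mul1r.
have m_dvd_i : (m %| i)%N.
  rewrite /dvdn; case: posnP => // i_gt0.
  (* A nonzero remainder r would make chi ^ r trivial on g, hence everywhere. *)
  have im_range : (0 < i %% m < m)%N by rewrite i_gt0 ltn_mod.
  case/negP: (chi_nt _ im_range); apply/forallP => v; have [j ->] := powg v.
  by rewrite mchar_expE mcharX -exprM mulnC exprM gi_modm expr1n.
rewrite inE uval_neq0; apply/existsP; exists (val (g ^+ (i %/ m))%g).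
by rewrite -FinRing.val_unitX -expgM divnK // u_gi.
Qed.

Lemma Hset_imset_mchar_ker (F : finFieldType) (C : fieldType)
    (chi : mchar F C) (m : nat) :
  mchar_has_order chi m -> Hset F m = val @: [set u | chi u == 1].
Proof.
move=> chi_m; apply/setP => x; apply/idP/imsetP => [Hx|[u]].
  have x_unit : x \is a GRing.unit by rewrite unitfE (Hset_neq0 Hx).
  by exists (FinRing.unit F x_unit); rewrite // inE -(Hset_mchar_ker _ chi_m).
by rewrite inE -(Hset_mchar_ker _ chi_m) // => Hu ->.
Qed.

Lemma card_Hset (F : finFieldType) (C : numFieldType) (chi : mchar F C)
    (m : nat) :
  mchar_has_order chi m -> (m * #|Hset F m| = #|{: {unit F}}|)%N.
Proof.
move=> chi_m; rewrite (Hset_imset_mchar_ker chi_m).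
by rewrite card_imset ?(mchar_ker_card chi_m) //; apply: val_inj.
Qed.

(** * Characters extended by zero *)

Lemma mchar_eval_unit (F : finFieldType) (C : fieldType) (chi : mchar F C)
    (u : {unit F}) :
  mchar_eval chi (val u) = chi u.
Proof. by rewrite /mchar_eval valK. Qed.

Lemma mchar_eval0 (F : finFieldType) (C : fieldType) (chi : mchar F C) :
  ~~ mchar_trivial chi -> mchar_eval chi 0 = 0.
Proof. by move=> /negPf chi_nt; rewrite /mchar_eval insubF ?unitr0 ?chi_nt. Qed.

Lemma mchar_evalM (F : finFieldType) (C : fieldType) (chi : mchar F C)
    (x y : F) :
  ~~ mchar_trivial chi ->
  mchar_eval chi (x * y) = mchar_eval chi x * mchar_eval chi y.
Proof.
move=> chi_nt.
have [->|x0] := eqVneq x 0; first by rewrite mul0r mchar_eval0 ?mul0r.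
have [->|y0] := eqVneq y 0; first by rewrite mulr0 mchar_eval0 ?mulr0.
rewrite -unitfE in x0; rewrite -unitfE in y0.
rewrite -[x]/(val (FinRing.unit F x0)) -[y]/(val (FinRing.unit F y0)).
by rewrite -FinRing.val_unitM !mchar_eval_unit mcharM.
Qed.

Lemma mchar_eval_Hset (F : finFieldType) (C : fieldType) (chi : mchar F C)
    (m s : nat) (x : F) :
  mchar_has_order chi m -> x \in Hset F m ->
  mchar_eval (mchar_exp chi s%:Z) x = 1.
Proof.
move=> chi_m Hx; have x_unit : x \is a GRing.unit.
  by rewrite unitfE (Hset_neq0 Hx).
move: Hx; rewrite -[x]/(val (FinRing.unit F x_unit)).
by rewrite (Hset_mchar_ker _ chi_m) mchar_eval_unit mchar_expE
  => /eqP ->; rewrite expr1n.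
Qed.

Lemma sum_units (F : finFieldType) (V : zmodType) (g : F -> V) :
  \sum_(x : F) g x = g 0 + \sum_(u : {unit F}) g (val u).
Proof.
rewrite (bigD1 0) //=; congr (_ + _).
rewrite (reindex_omap (val : {unit F} -> F) insub) => [|x]; last first.
  by rewrite -unitfE => x_unit; rewrite insubT.
by apply: eq_bigl => u; rewrite valK -unitfE (valP u) eqxx.
Qed.

(** * Counting differences *)

Definition diff_count (V : finZmodType) (D : {set V}) (a : V) : nat :=
  #|[set p in setX D D | p.1 - p.2 == a]|.

(** Sort the pairs of elements of [D] by their difference. *)
Lemma sum_diff_count (V : finZmodType) (C : pzRingType) (D : {set V})
    (g : V -> C) :
  \sum_a (diff_count D a)%:R * g a = \sum_(x in D) \sum_(y in D) g (x - y).
Proof.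
rewrite pair_big /=.
rewrite (partition_big (fun p : V * V => p.1 - p.2) predT) //=.
apply: eq_bigr => a _.
rewrite (eq_bigr (fun=> g a)) => [|p /andP[_ /eqP ->] //].
rewrite sumr_const mulr_natl; congr (_ *+ _).
by apply: eq_card => p; rewrite !inE.
Qed.

Lemma diff_count0 (V : finZmodType) (D : {set V}) : diff_count D 0 = #|D|.
Proof.
rewrite /diff_count -(card_imset D (f := fun x => (x, x))) => [|x y []//].
apply: eq_card => -[x y]; rewrite !inE /= subr_eq0.
apply/idP/imsetP => [/andP[/andP[Dx _] /eqP <-]|[z Dz [-> ->]]].
  by exists x.
by rewrite Dz eqxx.
Qed.

(** Scaling both entries by [h] permutes the pairs of elements of [D]. *)
Lemma diff_count_mulr (F : finFieldType) (D : {set F}) (h a : F) :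
  h != 0 -> (forall x, (h * x \in D) = (x \in D)) ->
  diff_count D (h * a) = diff_count D a.
Proof.
move=> h0 hD; pose mulh (p : F * F) := (h * p.1, h * p.2).
have mulh_inj : injective mulh.
  by case=> x y [x' y'] [/(mulfI h0) -> /(mulfI h0) ->].
rewrite /diff_count -(card_imset [set p in setX D D | p.1 - p.2 == a] mulh_inj).
apply: eq_card => -[x y]; apply/idP/imsetP => [|[[x' y']]]; rewrite !inE /=.
  rewrite -[x](mulVKf h0) -[y](mulVKf h0) !hD -mulrBr.
  rewrite (inj_eq (mulfI h0)) => xyP.
  by exists (h^-1 * x, h^-1 * y); rewrite ?inE.
by move=> xyP [-> ->]; rewrite !hD -mulrBr (inj_eq (mulfI h0)).
Qed.

(** All pairs in [D] minus the diagonal, that is, [sum_diff_count] for the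
    constant function [1] without its term at the difference [0]. *)
Lemma sum_diff_count_units (F : finFieldType) (D : {set F}) :
  (\sum_(u : {unit F}) diff_count D (val u) = #|D| * (#|D| - 1))%N.
Proof.
have /eqP := sum_diff_count D (fun=> 1 : int).
rewrite sum_units diff_count0 /= mulr1.
under [X in _ == X]eq_bigr do rewrite sumr_const.
under eq_bigr do rewrite mulr1.
rewrite sumr_const -mulrnA -natr_sum -natrD eqr_nat => /eqP.
by rewrite mulnBr muln1 => <-; rewrite addKn.
Qed.

(** This links the Fourier coefficients of the difference function of
    [Mset F m] to the character sums.  Let [psi] be [chi ^ s]; then [psi] is [1]
    on the [m]th powers and [0] at [0].  In the sum of [psi (x - y)] over the
    pairs, those with [y = 0 != x] give [#|H|], those with [x = 0 != y] give
    [#|H| psi (-1)], and those with [x] and [y] nonzero give [#|H|] copies of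
    the sum of [psi (1 - z)] over [z] in [H], because [x - y = x (1 - y / x)] and [psi x = 1]. *)
Lemma sum_diff_count_mchar (F : finFieldType) (C : fieldType)
    (chi : mchar F C) (m s : nat) :
  mchar_has_order chi m -> ~~ mchar_trivial (mchar_exp chi s%:Z) ->
  \sum_(u : {unit F}) (diff_count (Mset F m) (val u))%:R * chi u ^+ s
    = #|Hset F m|%:R * (1 + mchar_eval (mchar_exp chi s%:Z) (- 1)
        + \sum_(x in Hset F m) mchar_eval (mchar_exp chi s%:Z) (1 - x)).
Proof.
move=> chi_m psi_nt; set psi := mchar_exp chi s%:Z in psi_nt *.
have psiH x : x \in Hset F m -> mchar_eval psi x = 1.
  exact: mchar_eval_Hset.
have := sum_diff_count (Mset F m) (mchar_eval psi).
rewrite sum_units mchar_eval0 // mulr0 add0r.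
under eq_bigr do rewrite mchar_eval_unit mchar_expE.
move=> ->; rewrite big_Mset.
have -> : \sum_(y in Mset F m) mchar_eval psi (0 - y)
    = #|Hset F m|%:R * mchar_eval psi (- 1).
  rewrite big_Mset subr0 mchar_eval0 // add0r mulr_natl -sumr_const.
  apply: eq_bigr => y /psiH Hy.
  by rewrite sub0r -[- y]mulN1r mchar_evalM // Hy mulr1.
rewrite [1 + _]addrC -addrA mulrDr; congr (_ + _).
rewrite mulr_natl -sumr_const; apply: eq_bigr => x Hx.
rewrite big_Mset subr0 psiH //; congr (_ + _).
rewrite (reindex_inj (mulfI (Hset_neq0 Hx))) /=.
apply: eq_big => y; first exact: Hset_mull.
by move=> _; rewrite -{1}[x]mulr1 -mulrBr mchar_evalM // psiH // mul1r.
Qed.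

Theorem theorem3p4 (R : realType) (F : finFieldType) (q m f lambda : nat)
    (chi : mchar F R[i]) :
  #|F| = q -> q = (m * f + 1)%N -> (0 < m)%N -> (0 < f)%N ->
  (f + 1)%N = (lambda * m)%N ->
  mchar_has_order chi m ->
  is_difference_set q (f + 1) lambda (Mset F m) <->
  (forall s : nat, (1 <= s <= m - 1)%N ->
     \sum_(alpha in Hset F m) mchar_eval (mchar_exp chi s%:Z) (1 - alpha)
       = - 1 - mchar_eval (mchar_exp chi s%:Z) (- 1)).
Proof.
move=> card_F q_mf m_gt0 f_gt0 f_lm chi_m; have [_ _ chi_nt] := chi_m.
have card_U : #|{: {unit F}}| = (m * f)%N.
  by rewrite -cardsT card_finField_unit card_F q_mf addn1.
have card_H : #|Hset F m| = f.
  by apply/eqP; rewrite -(eqn_pmul2l m_gt0) (card_Hset chi_m) card_U.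
have card_M : #|Mset F m| = (f + 1)%N by rewrite card_Mset card_H.
pose N u : R[i] := (diff_count (Mset F m) (val (u : {unit F})))%:R.
have N_ker u v : chi v = 1 -> N (u * v)%g = N u.
  move=> /eqP; rewrite -(Hset_mchar_ker _ chi_m) => Hv.
  rewrite /N FinRing.val_unitM mulrC diff_count_mulr ?(Hset_neq0 Hv) //.
  by move=> x; rewrite Mset_mull.
have sum_N : \sum_u N u = #|{: {unit F}}|%:R * lambda%:R.
  rewrite -natr_sum sum_diff_count_units card_M addnK card_U -natrM f_lm.
  by congr _%:R; rewrite -mulnA mulnC.
have const_iff := coset_invariant_const chi_m N_ker sum_N.
have s_range s : (1 <= s <= m - 1)%N = (0 < s < m)%N.
  by rewrite subn1 -[(s <= _)%N]ltnS prednK.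
have vanish_iff s : (0 < s < m)%N ->
    \sum_u N u * chi u ^+ s = 0 <->
    \sum_(alpha in Hset F m) mchar_eval (mchar_exp chi s%:Z) (1 - alpha)
       = - 1 - mchar_eval (mchar_exp chi s%:Z) (- 1).
  move=> s_m; rewrite /N (sum_diff_count_mchar chi_m) ?chi_nt //.
  rewrite card_H -opprD.
  have f_neq0 : f%:R != 0 :> R[i] by rewrite pnatr_eq0 -lt0n.
  split=> [/eqP|->]; last by rewrite subrr mulr0.
  by rewrite mulf_eq0 (negPf f_neq0) addrC addr_eq0 => /eqP.
split=> [[_ _ M_diff] s|char_sums].
  rewrite s_range => s_m; apply/(vanish_iff s s_m).
  apply: (const_iff.1 _ s s_m) => u.
  by rewrite /N [diff_count _ _]M_diff // -unitfE (valP u).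
split=> // a a0; rewrite -unitfE in a0.
suff /eqP : N (FinRing.unit F a0) = lambda%:R.
  by rewrite eqr_nat => /eqP.
apply: const_iff.2 => s s_m; apply/(vanish_iff s s_m)/char_sums.
by rewrite s_range.
Qed.
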